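(* Let $(M,d)$ be a multiplicative metric space and let $T:M\to M$ be a function such that for each couple of different points $x,y\in M$ at least one of the following conditions is satisfied: (I) $d(Tx,Ty)< d(x,y)$; (II) $d(Tx,Ty)< \big(d(x,Tx)\cdot d(y,Ty)\big)^{\frac12}$; (III) $d(Tx,Ty)< \big(d(x,Ty)\cdot d(y,Tx)\big)^{\frac12}$. If for some $x_0\in M$ the sequence $\{T^n x_0\}_{n=0}^{\infty}$ converges to a point $z\in M$, then $z$ is the unique fixed point of $T$.
   Context: A multiplicative metric on a nonempty set $X$ is a mapping $d:X\times X\to\mathbb{R}$ such that for all $x,y,z\in X$: $d(x,y)\ge 1$; $d(x,y)=1$ if and only if $x=y$; $d(x,y)=d(y,x)$; and $d(x,z)\le d(x,y)\cdot d(y,z)$. The pair $(X,d)$ is called a multiplicative metric space. A sequence $\{x_n\}$ in $X$ converges (multiplicatively) to $x\in X$ if for every $\epsilon>1$ there is a positive integer $n_0$ with $d(x_n,x)<\epsilon$ for all $n\ge n_0$. $T^n$ denotes the $n$-fold composition of $T$ with itself ($T^0$ is the identity). $T$ is not assumed continuous. *)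

(* Defs.v *)
From mathcomp Require Import all_boot all_order all_algebra.
From mathcomp Require Import reals exp.

Set Implicit Arguments.
Unset Strict Implicit.
Unset Printing Implicit Defensive.

Import Order.TTheory GRing.Theory Num.Theory.
Local Open Scope ring_scope.

(** Nonemptiness of [X] is not a field: it has to come from a given point. *)
Record is_mult_metric (R : realType) (X : Type) (d : X -> X -> R) : Prop :=
  IsMultMetric {
    mult_metric_ge1 : forall x y, 1 <= d x y;
    mult_metric_eq1 : forall x y, d x y = 1 <-> x = y;
    mult_metric_sym : forall x y, d x y = d y x;
    mult_metric_triangle : forall x y z, d x z <= d x y * d y z
  }.

Definition mult_converges (R : realType) (X : Type) (d : X -> X -> R)
    (u : nat -> X) (x : X) : Prop :=
  forall eps : R, 1 < eps ->
    exists2 n0 : nat, (0 < n0)%N & forall n, (n0 <= n)%N -> d (u n) x < eps.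

Definition is_unique_fixed_point (X : Type) (T : X -> X) (z : X) : Prop :=
  T z = z /\ forall w, T w = w -> w = z.

(* Main.v *)
Require Import Defs.
From mathcomp Require Import all_boot all_order all_algebra.
From mathcomp Require Import reals exp boolp.

Set Implicit Arguments.
Unset Strict Implicit.
Unset Printing Implicit Defensive.

Import Order.TTheory GRing.Theory Num.Theory.
Local Open Scope ring_scope.

(** If [T z] differs from [z], put [D = d (z, T z) > 1] and choose [e > 1] with
    [e ^ 4 < D].  For large [n] the point [x = T^n x0] differs from [z] and both
    [x] and [T x] lie within [e] of [z].  Each of the three conditions then gives
    [d (T x, T z) ^ 2 <= e ^ 2 * D], so that
    [D ^ 2 <= (d (z, T x) * d (T x, T z)) ^ 2 <= e ^ 4 * D < D ^ 2]. *)

Lemma sqr_lt_of_lt_powR_half (R : realType) (a b : R) :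
  0 <= a -> 0 <= b -> a < b `^ (1 / 2) -> a ^+ 2 < b.
Proof.
move=> a0 b0; rewrite div1r powR12_sqrt // => ab.
by rewrite -(sqr_sqrtr b0) ltr_pXn2r // nnegrE sqrtr_ge0.
Qed.

Lemma exists_gt1_expr4_lt (R : realType) (D : R) :
  1 < D -> exists2 e : R, 1 < e & e ^+ 4 < D.
Proof.
have sqrt_gt1 (x : R) : 1 < x -> 1 < Num.sqrt x.
  by move=> x1; rewrite -[ltLHS]sqrtr1 ltr_sqrt // (lt_trans ltr01).
move=> D1; set s := Num.sqrt D.
have s1 : 1 < s by exact: sqrt_gt1.
(* The witness is the eighth root of [D]: its fourth power is [s], the square root of [D], and
   [s < s * s = D]. *)
exists (Num.sqrt (Num.sqrt s)); first by rewrite !sqrt_gt1.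
rewrite (exprM _ 2 2) !sqr_sqrtr ?sqrtr_ge0 //.
have D0 : 0 <= D by rewrite ltW // (lt_trans ltr01).
by rewrite -[ltRHS](sqr_sqrtr D0) -/s expr2 ltr_pMl // (lt_trans ltr01).
Qed.

Definition mult_contractive_pair (R : realType) (M : Type) (d : M -> M -> R)
    (T : M -> M) (x y : M) : Prop :=
  [\/ d (T x) (T y) < d x y,
      d (T x) (T y) < (d x (T x) * d y (T y)) `^ (1 / 2) |
      d (T x) (T y) < (d x (T y) * d y (T x)) `^ (1 / 2)].

Section MultMetric.
Variables (R : realType) (M : Type) (d : M -> M -> R).
Hypothesis hd : is_mult_metric d.
Variable T : M -> M.

Let d_ge1 x y : 1 <= d x y := mult_metric_ge1 hd x y.
Let d_ge0 x y : 0 <= d x y := le_trans ler01 (d_ge1 x y).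

Lemma mult_metric_xx x : d x x = 1.
Proof. by apply/(mult_metric_eq1 hd). Qed.

(** This gives uniqueness: at two fixed points (I) collapses to [d x y < d x y], (II) to
    [d x y < 1], and (III), once squared, to [d x y ^+ 2 < d x y ^+ 2]. *)
Lemma mult_contractive_pair_fixed x y :
  T x = x -> T y = y -> ~ mult_contractive_pair d T x y.
Proof.
move=> Tx Ty; rewrite /mult_contractive_pair Tx Ty; case; first by rewrite ltxx.
- by rewrite !mult_metric_xx mulr1 powR1 ltNge d_ge1.
move/(sqr_lt_of_lt_powR_half (d_ge0 x y) (mulr_ge0 (d_ge0 x y) (d_ge0 y x))).
by rewrite (mult_metric_sym hd y x) expr2 ltxx.
Qed.

Lemma mult_contractive_pair_near x z (e : R) :
  d x z < e -> d (T x) z < e -> mult_contractive_pair d T x z ->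
  d z (T z) <= e ^+ 4.
Proof.
set D := d z (T z) => xz Txz xzT.
have e0 : 0 <= e by rewrite (le_trans (d_ge0 x z)) ?ltW.
have e1 : 1 <= e by rewrite (le_trans (d_ge1 x z)) ?ltW.
have D1 : 1 <= D by exact: d_ge1.
have D0 : 0 < D by exact: lt_le_trans ltr01 D1.
have zTx : d z (T x) <= e by rewrite (mult_metric_sym hd) ltW.
have TxTz : d (T x) (T z) ^+ 2 <= e ^+ 2 * D.
  case: xzT => [lt1|lt2|lt3].
  - apply: (@le_trans _ _ (e ^+ 2)); last by rewrite ler_peMr // exprn_ge0.
    by rewrite lerXn2r ?nnegrE // ltW // (lt_trans lt1).
  (* For (II), going through [z] gives [d x (T x) <= d x z * d z (T x) <= e ^+ 2]. *)
  - apply/ltW/(lt_le_trans (sqr_lt_of_lt_powR_half _ _ lt2)) => //.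
      by rewrite mulr_ge0.
    rewrite -/D ler_wpM2r ?(ltW D0) // (le_trans (mult_metric_triangle hd x z _)) //.
    by rewrite expr2 ler_pM // ltW.
  (* For (III), [d x (T z) <= d x z * D <= e * D], and the other factor [d z (T x)] is at most
     [e]. *)
  - apply/ltW/(lt_le_trans (sqr_lt_of_lt_powR_half _ _ lt3)) => //.
      by rewrite mulr_ge0.
    rewrite expr2 mulrAC ler_pM //.
    by rewrite (le_trans (mult_metric_triangle hd x z _)) // ler_wpM2r // ltW.
(* Multiplied by [D], the goal becomes [D ^+ 2 <= e ^+ 4 * D], within reach of the squared triangle
   inequality through [T x]. *)
rewrite -(ler_pM2r D0) -expr2.
apply: (@le_trans _ _ ((d z (T x) * d (T x) (T z)) ^+ 2)).
  by rewrite lerXn2r ?nnegrE ?mulr_ge0 ?(ltW D0) // (mult_metric_triangle hd).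
rewrite exprMn -[4%N]/(2 + 2)%N exprD -[leRHS]mulrA ler_pM ?exprn_ge0 //.
by rewrite lerXn2r ?nnegrE.
Qed.

Lemma mult_converges_iter_fixed x0 z :
  (forall x y, x <> y -> mult_contractive_pair d T x y) ->
  mult_converges d (fun n => iter n T x0) z -> T z = z.
Proof.
move=> hT hz; have [//|Tzz] := pselect (T z = z).
have D1 : 1 < d z (T z).
  rewrite lt_neqAle d_ge1 andbT eq_sym; apply/eqP.
  by move/(mult_metric_eq1 hd)/esym.
have [e e1 eD] := exists_gt1_expr4_lt D1.
have [n _ near] := hz e e1.
have xz := near n (leqnn n).
have Txz : d (T (iter n T x0)) z < e by exact: near n.+1 (leqnSn n).
have [xEz|xNz] := pselect (iter n T x0 = z).
(* If the orbit is at [z] at step [n], its next point is [T z], so that [D < e], against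
   [e <= e ^+ 4 < D]. *)
- have eD1 : e < d z (T z) by rewrite (le_lt_trans _ eD) // ler_eXnr // ltW.
  by have := lt_trans Txz eD1; rewrite xEz (mult_metric_sym hd) ltxx.
- have := mult_contractive_pair_near xz Txz (hT _ _ xNz).
  by rewrite leNgt eD.
Qed.

End MultMetric.

Theorem theorem3p6 (R : realType) (M : Type) (d : M -> M -> R)
  (hd : is_mult_metric d) (T : M -> M)
  (hT : forall x y : M, x <> y ->
     [\/ d (T x) (T y) < d x y,
         d (T x) (T y) < (d x (T x) * d y (T y)) `^ (1 / 2) |
         d (T x) (T y) < (d x (T y) * d y (T x)) `^ (1 / 2)])
  (x0 z : M)
  (hz : mult_converges d (fun n => iter n T x0) z) :
  is_unique_fixed_point T z.
Proof.
have Tz := mult_converges_iter_fixed hd hT hz.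
split=> // w Tw; have [//|wz] := pselect (w = z).
by case: (mult_contractive_pair_fixed hd Tw Tz (hT _ _ wz)).
Qed.
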